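(* Let $(T,q,t,w)$ be basic data with invertible corners and let $\Lambda=\Lambda(T,q,t,w)$ be the associated $2$-graph. Then the following are equivalent: (1) the shift maps $\sigma^{e_1}$ and $\sigma^{e_2}$ on $\Lambda^\infty$ $*$-commute; (2) $\Lambda(T,q,t,w)$ is $1$-coaligned; (3) the rule $w$ has three invertible corners.
   Context: $\mathbb{N}=\{0,1,2,\dots\}$; $\mathbf{0}$ is the zero vector of $\mathbb{N}^k$, $e_1,\dots,e_k$ are the standard generators of $\mathbb{N}^k$, and $\le$ is the coordinatewise order with join $\vee$. $*$-commuting: for a set $X$ and commuting functions $S,T:X\to X$, we say $S$ and $T$ $*$-commute if for every $(y,z)\in X\times X$ with $S(y)=T(z)$ there exists a unique $x\in X$ such that $T(x)=y$ and $S(x)=z$. $k$-graph: a $k$-graph is a pair $(\Lambda,d)$ consisting of a countable category $\Lambda$ and a functor $d:\Lambda\to\mathbb{N}^k$ (degree map; $\mathbb{N}^k$ is regarded as a monoid under addition) such that for every $\lambda\in\Lambda$ and $m,n\in\mathbb{N}^k$ with $d(\lambda)=m+n$ there are unique $\mu,\nu\in\Lambda$ with $d(\mu)=m$, $d(\nu)=n$ and $\lambda=\mu\nu$. Here $\mu\nu$ is defined when $s(\mu)=r(\nu)$, with $r,s$ the range and source; $\Lambda^n:=\{\lambda: d(\lambda)=n\}$. Infinite paths: $\Omega_k$ is the $k$-graph with object set $\mathbb{N}^k$, morphisms $\{(m,n)\in\mathbb{N}^k\times\mathbb{N}^k: m\le n\}$, $r(m,n)=m$, $s(m,n)=n$,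 composition $(m,n)(n,p)=(m,p)$, and degree $d(m,n)=n-m$. $\Lambda^\infty$ is the set of degree-preserving functors $x:\Omega_k\to\Lambda$. For $p\in\mathbb{N}^k$ the shift $\sigma^p:\Lambda^\infty\to\Lambda^\infty$ is $\sigma^p(x)(m,n)=x(m+p,n+p)$. $1$-coaligned: a $k$-graph $\Lambda$ is $1$-coaligned if for all $1\le i,j\le k$ with $i\ne j$ and all $(e^i,e^j)\in\Lambda^{e_i}\times\Lambda^{e_j}$ with $s(e^i)=s(e^j)$ there exists a unique pair $(f^i,f^j)\in\Lambda^{e_i}\times\Lambda^{e_j}$ such that $f^ie^j=f^je^i$. Basic data $(T,q,t,w)$: a finite (nonempty) hereditary subset $T\subset\mathbb{N}^2$, the tile (hereditary: $j\in T$ and $\mathbf{0}\le i\le j$ imply $i\in T$); an alphabet $\{0,\dots,q-1\}$ identified with $\mathbb{Z}/q\mathbb{Z}$; an element $t$ of the alphabet, the trace; and a function $w:T\to\{0,\dots,q-1\}$, the rule. Write $(c_1,c_2):=\bigvee\{i: i\in T\}$; it is assumed that $c_1,c_2>0$. The rule has invertible corners if $w(c_1e_1)$ and $w(c_2e_2)$ are invertible in $\mathbb{Z}/q\mathbb{Z}$. The rule $w$ has three invertible corners if $w(\mathbf{0})$, $w(c_1e_1)$ and $w(c_2e_2)$ are all invertible in $\mathbb{Z}/q\mathbb{Z}$ (with $c_1\ge1$, $c_2\ge1$). The $2$-graph $\Lambda(T,q,t,w)$ (for basic data with invertible corners): the vertex set is $$\Lambda^0=\Big\{v:T\to\mathbb{Z}/q\mathbb{Z}\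 \Big|\ \sum_{i\in T}w(i)v(i)\equiv t \pmod q\Big\}.$$ For $S\subset\mathbb{Z}^2$ and $n\in\mathbb{Z}^2$, $S+n=\{i+n:i\in S\}$; for $n\in\mathbb{N}^2$, $T(n):=\bigcup_{\mathbf{0}\le m\le n}(T+m)$. If $f:S\to\mathbb{Z}/q\mathbb{Z}$ with $T+n\subset S\subset\mathbb{N}^2$, then $f|_{T+n}:T\to\mathbb{Z}/q\mathbb{Z}$ denotes $i\mapsto f(i+n)$. A path of degree $n$ is a function $\lambda:T(n)\to\mathbb{Z}/q\mathbb{Z}$ such that $\lambda|_{T+m}$ is a vertex for all $\mathbf{0}\le m\le n$; its source is $s(\lambda)=\lambda|_{T+n}$ and its range is $r(\lambda)=\lambda|_T$. For $\lambda\in\Lambda^p$ and $\mathbf{0}\le m\le n\le p$, the segment $\lambda(m,n)$ is the path of degree $n-m$ given by $\lambda(m,n)(i)=\lambda(m+i)$ for $i\in T(n-m)$. For $\mu\in\Lambda^m$, $\nu\in\Lambda^n$ with $s(\mu)=r(\nu)$, the composite $\mu\nu$ is the unique path $\lambda\in\Lambda^{m+n}$ with $\lambda(\mathbf{0},m)=\mu$ and $\lambda(m,m+n)=\nu$ (existence and uniqueness hold because of the invertible corners, and this makes $\Lambda(T,q,t,w)$ a $2$-graph; these are known facts). *)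

(* Defs.v *)
From HB Require Import structures.
From mathcomp Require Import all_boot all_order all_algebra finmap.
From Stdlib Require Import FunctionalExtensionality ProofIrrelevance.

Set Implicit Arguments.
Unset Strict Implicit.
Unset Printing Implicit Defensive.

Import GRing.Theory.
Local Open Scope ring_scope.

(* 0 and + on NN k are the pointwise operations of the library. *)
Notation NN k := {ffun 'I_k -> nat}.

Definition ebase k (i : 'I_k) : NN k := [ffun j => (i == j : nat)].

Definition lev k (m n : NN k) : bool := [forall i, (m i <= n i)%N].

(* Truncated; only used for m <= n. *)
Definition subv k (n m : NN k) : NN k := [ffun i => (n i - m i)%N].

Definition box k (n : NN k) : seq (NN k) :=
  [seq ([ffun i => f i : nat] : NN k) | f : {dffun forall i : 'I_k, 'I_(n i).+1}].

Lemma levP k (m n : NN k) : reflect (forall i, (m i <= n i)%N) (lev m n).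
Proof. exact: forallP. Qed.

Lemma in_box k (m n : NN k) : (m \in box n) = lev m n.
Proof.
apply/mapP/levP => [[f _ ->] i|le_mn]; first by rewrite ffunE -ltnS.
exists ([ffun i => Ordinal (le_mn i : (m i < (n i).+1)%N)]
         : {dffun forall i : 'I_k, 'I_(n i).+1}); first by rewrite mem_enum.
by apply/ffunP => i; rewrite !ffunE.
Qed.

Lemma lev_refl k (n : NN k) : lev n n.
Proof. exact/levP. Qed.

Lemma lev_trans k (n m p : NN k) : lev m n -> lev n p -> lev m p.
Proof.
by move=> /levP mn /levP np; apply/levP => i; apply: leq_trans (mn i) (np i).
Qed.

Lemma addvE k (m n : NN k) i : (m + n) i = (m i + n i)%N.
Proof. by rewrite ffunE. Qed.

Lemma subvE k (m n : NN k) i : subv m n i = (m i - n i)%N.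
Proof. by rewrite ffunE. Qed.

Lemma lev_add2r k (p m n : NN k) : lev (m + p) (n + p) = lev m n.
Proof.
by apply/levP/levP => H i; have := H i; rewrite !addvE leq_add2r.
Qed.

(* countType makes the category countable.
   kcomp mu nu is meaningful only when src mu = rng nu; outside that case it is
   an arbitrary morphism about which nothing is assumed. *)
Record kgraph (k : nat) := KGraph {
  obj : countType;
  mor : countType;
  rng : mor -> obj;
  src : mor -> obj;
  idm : obj -> mor;
  kcomp : mor -> mor -> mor;
  deg : mor -> NN k;
  rng_idm : forall v, rng (idm v) = v;
  src_idm : forall v, src (idm v) = v;
  rng_comp : forall mu nu, src mu = rng nu -> rng (kcomp mu nu) = rng mu;
  src_comp : forall mu nu, src mu = rng nu -> src (kcomp mu nu) = src nu;
  comp_idl : forall mu, kcomp (idm (rng mu)) mu = mu;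
  comp_idr : forall mu, kcomp mu (idm (src mu)) = mu;
  comp_assoc : forall la mu nu, src la = rng mu -> src mu = rng nu ->
    kcomp la (kcomp mu nu) = kcomp (kcomp la mu) nu;
  deg_idm : forall v, deg (idm v) = 0;
  deg_comp : forall mu nu, src mu = rng nu ->
    deg (kcomp mu nu) = deg mu + deg nu;
  factorization : forall la m n, deg la = m + n ->
    exists! p : mor * mor, [/\ deg p.1 = m, deg p.2 = n,
      src p.1 = rng p.2 & la = kcomp p.1 p.2]
}.

Record kfunctor k (G H : kgraph k) := KFunctor {
  fobj : obj G -> obj H;
  fmor : mor G -> mor H;
  fmor_rng : forall mu, rng (fmor mu) = fobj (rng mu);
  fmor_src : forall mu, src (fmor mu) = fobj (src mu);
  fmor_idm : forall v, fmor (idm v) = idm (fobj v);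
  fmor_comp : forall mu nu, src mu = rng nu ->
    fmor (kcomp mu nu) = kcomp (fmor mu) (fmor nu);
  fmor_deg : forall mu, deg (fmor mu) = deg mu
}.

Lemma kfunctor_eq k (G H : kgraph k) (x y : kfunctor G H) :
  fobj x =1 fobj y -> fmor x =1 fmor y -> x = y.
Proof.
case: x y => [o m h1 h2 h3 h4 h5] [o' m' g1 g2 g3 g4 g5] /= eo em.
have Eo : o = o' by apply: functional_extensionality.
have Em : m = m' by apply: functional_extensionality.
move: h1 h2 h3 h4 h5 g1 g2 g3 g4 g5; rewrite {}Eo {}Em => *.
by f_equal; apply: proof_irrelevance.
Qed.

Section Omega.
Context (k : nat).

Definition Omega_mor := {p : NN k * NN k | lev p.1 p.2}.
HB.instance Definition _ := Countable.on Omega_mor.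

Definition Omega_rng (p : Omega_mor) : NN k := (val p).1.
Definition Omega_src (p : Omega_mor) : NN k := (val p).2.
Definition Omega_idm (n : NN k) : Omega_mor :=
  exist (fun p : NN k * NN k => lev p.1 p.2) (n, n) (lev_refl n).
(* (m, n) followed by (n, p) is (m, p); the default p is for m <= p failing. *)
Definition Omega_comp (p q : Omega_mor) : Omega_mor :=
  insubd p (Omega_rng p, Omega_src q).
Definition Omega_deg (p : Omega_mor) : NN k :=
  subv (Omega_src p) (Omega_rng p).

Lemma Omega_eq (p q : Omega_mor) :
  Omega_rng p = Omega_rng q -> Omega_src p = Omega_src q -> p = q.
Proof.
move=> e1 e2; apply: val_inj.
by rewrite [LHS]surjective_pairing [RHS]surjective_pairing; congr pair.
Qed.

Lemma Omega_compE p q : Omega_src p = Omega_rng q ->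
  val (Omega_comp p q) = (Omega_rng p, Omega_src q).
Proof.
move=> e; rewrite val_insubd /=; case: ifP => // /negP[].
by apply: lev_trans (valP p) _; have := valP q; rewrite -[X in lev X _]e.
Qed.

Lemma Omega_rng_comp p q : Omega_src p = Omega_rng q ->
  Omega_rng (Omega_comp p q) = Omega_rng p.
Proof. by move/Omega_compE=> e; rewrite /Omega_rng e. Qed.

Lemma Omega_src_comp p q : Omega_src p = Omega_rng q ->
  Omega_src (Omega_comp p q) = Omega_src q.
Proof. by move/Omega_compE=> e; rewrite /Omega_src e. Qed.

Lemma Omega_comp_idl p : Omega_comp (Omega_idm (Omega_rng p)) p = p.
Proof. by apply: Omega_eq; rewrite ?Omega_rng_comp ?Omega_src_comp. Qed.

Lemma Omega_comp_idr p : Omega_comp p (Omega_idm (Omega_src p)) = p.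
Proof. by apply: Omega_eq; rewrite ?Omega_rng_comp ?Omega_src_comp. Qed.

Lemma Omega_comp_assoc p q t :
  Omega_src p = Omega_rng q -> Omega_src q = Omega_rng t ->
  Omega_comp p (Omega_comp q t) = Omega_comp (Omega_comp p q) t.
Proof.
move=> e1 e2.
by apply: Omega_eq; rewrite !(Omega_rng_comp, Omega_src_comp).
Qed.

Lemma Omega_deg_idm n : Omega_deg (Omega_idm n) = 0.
Proof. by apply/ffunP=> i; rewrite !ffunE subnn. Qed.

Lemma Omega_deg_comp p q : Omega_src p = Omega_rng q ->
  Omega_deg (Omega_comp p q) = Omega_deg p + Omega_deg q.
Proof.
move=> e; rewrite /Omega_deg Omega_rng_comp // Omega_src_comp // e.
have /levP H1 := valP p; have /levP H2 := valP q.
apply/ffunP=> i; rewrite addvE !subvE -e.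
have h1 : (Omega_rng p i <= Omega_src p i)%N := H1 i.
have h2 : (Omega_rng q i <= Omega_src q i)%N := H2 i.
by rewrite -e in h2; rewrite addnC addnBA // subnK.
Qed.

Lemma Omega_factorization p (m n : NN k) : Omega_deg p = m + n ->
  exists! u : Omega_mor * Omega_mor, [/\ Omega_deg u.1 = m,
    Omega_deg u.2 = n, Omega_src u.1 = Omega_rng u.2 &
    p = Omega_comp u.1 u.2].
Proof.
have degS (t : Omega_mor) l : Omega_deg t = l -> Omega_src t = Omega_rng t + l.
  move=> <-; apply/ffunP=> i; rewrite addvE subvE subnKC //.
  by have /levP := valP t; apply.
move/degS=> sp; set a := Omega_rng p in sp.
have le1 : lev a (a + m) by apply/levP=> i; rewrite addvE leq_addr.
have le2 : lev (a + m) (a + (m + n)).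
  by apply/levP=> i; rewrite addrA [leqRHS]addvE leq_addr.
pose u1 : Omega_mor := exist (fun p : NN k * NN k => lev p.1 p.2) (_, _) le1.
pose u2 : Omega_mor := exist (fun p : NN k * NN k => lev p.1 p.2) (_, _) le2.
exists (u1, u2); split=> [|[v1 v2] /= [d1 d2 e ep]].
  split=> //=.
  - by apply/ffunP=> i; rewrite subvE addvE addKn.
  - apply/ffunP=> i; rewrite subvE /Omega_src /Omega_rng /=.
    by rewrite addrA [X in (X - _)%N]addvE addKn.
  - by apply: Omega_eq; rewrite ?Omega_rng_comp ?Omega_src_comp.
have r1 : Omega_rng v1 = a by rewrite /a ep Omega_rng_comp.
have s1 : Omega_src v1 = a + m by rewrite (degS _ _ d1) r1.
congr pair; apply: Omega_eq => //.
- by rewrite -e s1.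
- by rewrite (degS _ _ d2) -e s1 -addrA.
Qed.

Definition Omega : kgraph k :=
  @KGraph k (NN k) Omega_mor Omega_rng Omega_src Omega_idm Omega_comp Omega_deg
    (fun _ => erefl) (fun _ => erefl) Omega_rng_comp Omega_src_comp
    Omega_comp_idl Omega_comp_idr Omega_comp_assoc Omega_deg_idm Omega_deg_comp
    Omega_factorization.

Definition translate (p : NN k) (u : Omega_mor) : Omega_mor :=
  exist (fun p : NN k * NN k => lev p.1 p.2)
    (Omega_rng u + p, Omega_src u + p)
    (etrans (lev_add2r p _ _) (valP u)).

Lemma translate_idm p (v : NN k) :
  translate p (Omega_idm v) = Omega_idm (v + p).
Proof. exact: Omega_eq. Qed.

Lemma translate_comp p (u v : Omega_mor) : Omega_src u = Omega_rng v ->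
  translate p (Omega_comp u v) = Omega_comp (translate p u) (translate p v).
Proof.
move=> e; have e' : Omega_src (translate p u) = Omega_rng (translate p v).
  by rewrite /Omega_src /Omega_rng /= e.
apply: Omega_eq; rewrite ?Omega_rng_comp ?Omega_src_comp //.
  by rewrite /(Omega_rng (translate _ _)) /= Omega_rng_comp.
by rewrite /(Omega_src (translate _ _)) /= Omega_src_comp.
Qed.

Lemma translate_deg p (u : Omega_mor) :
  Omega_deg (translate p u) = Omega_deg u.
Proof.
by apply/ffunP=> i; rewrite !subvE !addvE subnDr.
Qed.


End Omega.

Definition inf_path k (L : kgraph k) := kfunctor (Omega k) L.

Section Shift.
Context (k : nat) (L : kgraph k) (p : NN k) (x : inf_path L).

Let sobj (m : obj (Omega k)) : obj L := fobj x (m + p).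
Let smor (u : mor (Omega k)) : mor L := fmor x (translate p u).

Lemma shift_rng u : rng (smor u) = sobj (rng u).
Proof. exact: fmor_rng. Qed.

Lemma shift_src u : src (smor u) = sobj (src u).
Proof. exact: fmor_src. Qed.

Lemma shift_idm v : smor (idm v) = idm (sobj v).
Proof. by rewrite /smor /= translate_idm (fmor_idm x). Qed.

Lemma shift_comp u v : src u = rng v ->
  smor (kcomp u v) = kcomp (smor u) (smor v).
Proof.
move=> e; rewrite /smor /= translate_comp // (fmor_comp x) //.
by rewrite /= /Omega_src /Omega_rng /=; congr (_ + _).
Qed.

Lemma shift_deg u : deg (smor u) = deg u.
Proof. by rewrite /smor (fmor_deg x) /= translate_deg. Qed.

Definition shift : inf_path L :=
  KFunctor shift_rng shift_src shift_idm shift_comp shift_deg.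

End Shift.

Definition star_commute (X : Type) (S T : X -> X) : Prop :=
  (forall x, S (T x) = T (S x)) /\
  (forall y z, S y = T z -> exists! x, T x = y /\ S x = z).

Definition one_coaligned k (L : kgraph k) : Prop :=
  forall i j : 'I_k, i != j ->
  forall ei ej : mor L, deg ei = ebase i -> deg ej = ebase j ->
    src ei = src ej ->
  exists! f : mor L * mor L,
    [/\ deg f.1 = ebase i, deg f.2 = ebase j,
        src f.1 = rng ej, src f.2 = rng ei &
        kcomp f.1 ej = kcomp f.2 ei].

(* The join of the elements of T. *)
Definition corner (T : {fset NN 2}) : NN 2 :=
  [ffun a => \max_(i : T) (val i) a]%N.

(* The alphabet is 'I_q rather than 'Z_q: arithmetic is that of nat taken
   modulo q, so that q = 1 is not distorted. *)
Record basic_data := BasicData {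
  tile : {fset NN 2};
  alph : nat;
  trace : 'I_alph;
  rule : tile -> 'I_alph;
  tile_neq0 : tile != fset0;
  tile_hered : forall i j : NN 2, j \in tile -> lev i j -> i \in tile;
  corner_gt0 : forall a : 'I_2, (0 < corner tile a)%N
}.

Definition unit_mod (q : nat) (a : 'I_q) : Prop :=
  exists b : 'I_q, (a * b = 1 %[mod q])%N.

Definition unit_at (D : basic_data) (p : NN 2) : Prop :=
  exists i : tile D, val i = p /\ unit_mod (rule i).

Definition invertible_corners (D : basic_data) : Prop :=
  forall a : 'I_2, unit_at D (ebase a *+ corner (tile D) a).

Definition three_invertible_corners (D : basic_data) : Prop :=
  unit_at D 0 /\ invertible_corners D.

Section TileGraph.
Context (D : basic_data).

Local Notation T := (tile D).
Local Notation q := (alph D).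
Local Notation c := (corner (tile D)).

Definition is_vertex (v : {ffun T -> 'I_q}) : bool :=
  (\sum_(i : T) rule i * v i == trace D %[mod q])%N.

Definition tiles (n : NN 2) : {fset NN 2} :=
  [fset (i + m)%R | i in T, m in box n]%fset.

(* The value of f at x; the junk value trace D is taken for x \notin S. *)
Definition look (S : {fset NN 2}) (f : {ffun S -> 'I_q}) (x : NN 2) : 'I_q :=
  if insub x is Some i then f i else trace D.

(* i |-> f (i + n) on S', for S' + n contained in S. *)
Definition restr (S S' : {fset NN 2}) (f : {ffun S -> 'I_q}) (n : NN 2) :
  {ffun S' -> 'I_q} := [ffun i => look f (val i + n)].

Definition vert := {v : {ffun T -> 'I_q} | is_vertex v}.
HB.instance Definition _ := Countable.on vert.

Definition path_of (n : NN 2) :=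
  {l : {ffun tiles n -> 'I_q} |
    all (fun m => is_vertex (restr T l m)) (box n)}.
HB.instance Definition _ n := Finite.on (path_of n).

Definition tpath := {n : NN 2 & path_of n}.
HB.instance Definition _ := Countable.on tpath.

Definition tdeg (x : tpath) : NN 2 := tag x.
Definition pval (x : tpath) : {ffun tiles (tdeg x) -> 'I_q} := val (tagged x).

(* The picked path is the l of degree tdeg x + tdeg y whose segments
   l(0, tdeg x) and l(tdeg x, tdeg x + tdeg y) are x and y. *)
Definition tcomp (x y : tpath) : tpath :=
  if [pick l : path_of (tdeg x + tdeg y) |
       (restr (tiles (tdeg x)) (val l) 0 == pval x)
       && (restr (tiles (tdeg y)) (val l) (tdeg x) == pval y)]
  is Some l then Tagged path_of l else x.

Definition valid (g : NN 2 -> 'I_q) (n : NN 2) : bool :=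
  (\sum_(i : T) rule i * g (val i + n)%R == trace D %[mod q])%N.

Lemma look_in (S : {fset NN 2}) (f : {ffun S -> 'I_q}) (i : S) :
  look f (val i) = f i.
Proof. by rewrite /look valK. Qed.

Lemma look_restr (S S' : {fset NN 2}) (f : {ffun S -> 'I_q}) n x :
  x \in S' -> look (restr S' f n) x = look f (x + n).
Proof. by move=> xS; rewrite -[x]/(val [` xS]%fset) look_in ffunE. Qed.

Lemma is_vertex_restr (S : {fset NN 2}) (f : {ffun S -> 'I_q}) n :
  is_vertex (restr T f n) = valid (look f) n.
Proof. by rewrite /is_vertex /valid; under eq_bigr do rewrite ffunE. Qed.

Lemma eq_valid g h n :
  (forall i, i \in T -> g (i + n) = h (i + n)) -> valid g n = valid h n.
Proof.
by move=> gh; rewrite /valid; under eq_bigr => i _ do rewrite gh ?(valP i) //.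
Qed.

Lemma valid_shift g m n : valid (fun x => g (x + m)) n = valid g (n + m).
Proof. by rewrite /valid; under eq_bigr do rewrite -addrA. Qed.

Lemma in_tiles x n :
  reflect (exists i m, [/\ i \in T, lev m n & x = i + m]) (x \in tiles n).
Proof.
apply: (iffP (imfset2P _ _ _ _ _)) => [[i iT [m mB ->]]|[i [m [iT mn ->]]]].
  by exists i, m; split=> //; rewrite -in_box.
by exists i => //; exists m => //; rewrite /= in_box.
Qed.

Lemma mem_tiles i m n : i \in T -> lev m n -> i + m \in tiles n.
Proof. by move=> iT mn; apply/in_tiles; exists i, m. Qed.

Lemma lev0 (n : NN 2) : lev 0 n.
Proof. by apply/levP=> i; rewrite ffunE. Qed.

Lemma lev_addl (m n : NN 2) : lev m (m + n).
Proof. by apply/levP=> i; rewrite addvE leq_addr. Qed.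

Lemma tiles_mono x m n : x \in tiles m -> lev m n -> x \in tiles n.
Proof.
move=> /in_tiles[i [j [iT jm ->]]] mn.
by apply: mem_tiles => //; apply: lev_trans mn.
Qed.

Lemma tiles_shift x m n : x \in tiles n -> x + m \in tiles (m + n).
Proof.
move=> /in_tiles[i [j [iT jn ->]]]; rewrite -addrA.
by apply: mem_tiles => //; rewrite [m + n]addrC lev_add2r.
Qed.

Lemma tile_tiles x n : x \in T -> x \in tiles n.
Proof. by move=> xT; rewrite -[x]addr0; apply: mem_tiles (lev0 n). Qed.

Lemma tiles0 x : x \in tiles 0 -> x \in T.
Proof.
move=> /in_tiles[i [m [iT /levP m0 ->]]].
suff -> : m = 0 by rewrite addr0.
by apply/ffunP=> a; have := m0 a; rewrite ffunE leqn0 => /eqP.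
Qed.

Lemma le_corner i a : i \in T -> (i a <= c a)%N.
Proof.
move=> iT; rewrite ffunE; exact: (leq_bigmax ([` iT]%fset : T)).
Qed.

Lemma scaleE (a j : 'I_2) n : (ebase a *+ n) j = ((a == j) * n)%N.
Proof.
elim: n => [|n IH]; first by rewrite mulr0n ffunE muln0.
by rewrite mulrS addvE IH ffunE mulnS.
Qed.

Lemma ord2 (a b j : 'I_2) : a != b -> (j = a) \/ (j = b).
Proof.
by case: a b j => [[|[|//]] p] [[|[|//]] p'] [[|[|//]] p''] // _;
   [left|right|right|left]; apply: val_inj.
Qed.

Lemma lev2 (a b : 'I_2) (m n : NN 2) : a != b ->
  (m a <= n a)%N -> (m b <= n b)%N -> lev m n.
Proof. by move=> ab h1 h2; apply/levP=> j; case: (ord2 j ab) => ->. Qed.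

Lemma eq2 (a b : 'I_2) (m n : NN 2) : a != b -> m a = n a -> m b = n b -> m = n.
Proof. by move=> ab h1 h2; apply/ffunP=> j; case: (ord2 j ab) => ->. Qed.

Lemma subvK (m n : NN 2) : lev m n -> subv n m + m = n.
Proof. by move=> /levP mn; apply/ffunP=> i; rewrite addvE subvE subnK. Qed.

Lemma addv_inj (m : NN 2) : injective (fun x : NN 2 => x + m).
Proof.
move=> x y /ffunP e; apply/ffunP=> i; have := e i.
by rewrite !addvE => /addIn.
Qed.

Definition agree (g h : NN 2 -> 'I_q) n :=
  forall i, i \in T -> g (i + n) = h (i + n).

Section Corner.
Context (a b : 'I_2) (ab : a != b) (ua : unit_at D (ebase a *+ c a)).

Lemma ba_false : (b == a) = false.
Proof. by rewrite eq_sym; exact: negbTE. Qed.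

Definition mkp (x y : nat) : NN 2 := [ffun j => if j == a then x else y].

Lemma mkpa x y : mkp x y a = x.
Proof. by rewrite ffunE eqxx. Qed.

Lemma mkpb x y : mkp x y b = y.
Proof. by rewrite ffunE ba_false. Qed.

Lemma mkpK (n : NN 2) : mkp (n a) (n b) = n.
Proof. by apply: eq2 ab _ _; rewrite ?mkpa ?mkpb. Qed.

Lemma tile_cases i : i \in T -> i <> ebase a *+ c a ->
  (exists2 j, j \in T & i = j + ebase b) \/ (i + ebase a \in T).
Proof.
case: ua => k [kE _] iT ik; case: (posnP (i b)) => ib; last first.
  left; exists (subv i (ebase b)).
    by apply: tile_hered iT _; apply/levP=> l; rewrite subvE leq_subr.
  apply/ffunP=> l; rewrite addvE subvE ffunE; case: eqP => [<-|_].
    by rewrite subnK.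
  by rewrite subn0 addn0.
right; apply: (@tile_hered D _ (ebase a *+ c a)); first by rewrite -kE; exact: valP.
apply: (lev2 ab); rewrite addvE ffunE scaleE ?eqxx ?(negbTE ab) ?ib // mul1n addn1.
rewrite ltn_neqAle le_corner // andbT; apply/eqP=> ia; apply: ik.
by apply: eq2 ab _ _; rewrite scaleE ?eqxx ?mul1n ?(negbTE ab).
Qed.

Lemma modq_sub (k : T) (g : NN 2 -> 'I_q) n :
  valid g n = ((rule k * g (val k + n)%R
    + \sum_(i : T | i != k) rule i * g (val i + n)%R)%N == trace D %[mod q])%N.
Proof. by rewrite /valid (bigD1 k). Qed.

Lemma corner_uniq g h n m : valid g n -> valid h n ->
  agree g h (n + ebase b) -> n = m + ebase a -> agree g h m -> agree g h n.
Proof.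
move=> vg vh gb nE gm; case: (ua) => k [kE [v uv]].
have off i : i \in T -> i <> val k -> g (i + n) = h (i + n).
  move=> iT; rewrite kE => /(tile_cases iT)[[j jT ->]|iaT].
    by have := gb _ jT; rewrite [n + _]addrC addrA.
  by have := gm _ iaT; rewrite -addrA [ebase a + m]addrC -nE.
move=> i iT; have [->|/eqP/off] := eqVneq i (val k); last exact.
move: vg vh; rewrite !(modq_sub k).
rewrite (eq_bigr (fun i : T => rule i * h (val i + n)%R)%N); last first.
  by move=> j jk; rewrite off ?(valP j) //; apply/eqP; rewrite (inj_eq val_inj).
move=> /eqP e1 /eqP e2; move/eqP: e1; rewrite -e2 eqn_modDr => /eqP e.
apply: val_inj => /=; rewrite -[LHS](modn_small (ltn_ord _)) -[RHS](modn_small (ltn_ord _)).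
have E (z : 'I_q) : (z = v * (rule k * z) %[mod q])%N.
  by rewrite mulnA [(v * _)%N]mulnC -modnMml uv modnMml mul1n.
by rewrite [LHS]E [RHS]E -modnMmr e modnMmr.
Qed.

Lemma corner_step g n : exists g', valid g' n /\
  (forall x, x <> ebase a *+ c a + n -> g' x = g x).
Proof.
case: (ua) => k [kE [v uv]].
pose A := (\sum_(i : T | i != k) rule i * g (val i + n)%R)%N.
have q0 : (0 < q)%N := leq_ltn_trans (leq0n _) (ltn_ord (trace D)).
pose z := Ordinal (ltn_pmod (v * (trace D + A * q.-1)) q0).
exists (fun x => if x == ebase a *+ c a + n then z else g x); split; last first.
  by move=> x /eqP/negbTE->.
rewrite (modq_sub k) kE eqxx (eq_bigr (fun i : T => rule i * g (val i + n)%R)%N); last first.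
  move=> i ik; case: eqP => // /addv_inj; rewrite -kE => /val_inj ik'.
  by rewrite ik' eqxx in ik.
rewrite -/A /= -modnDml modnMmr mulnA -modnMml uv modnMml mul1n modnDml.
by rewrite -addnA -mulnSr prednK // addnC modnMDl.
Qed.


Lemma row_step g x0 y l : exists g',
  (forall x, (x0 <= x < x0 + l)%N -> valid g' (mkp x y)) /\
  (forall p : NN 2, ~~ ((x0 + c a <= p a) && (p b == y))%N -> g' p = g p).
Proof.
elim: l => [|l [g1 [v1 e1]]].
  by exists g; split=> // x; rewrite addn0 => /andP[/leq_ltn_trans h /h]; rewrite ltnn.
have [g2 [v2 e2]] := corner_step g1 (mkp (x0 + l) y).
exists g2; split=> [x|p pn].
  rewrite addnS ltnS [(x <= _)%N]leq_eqVlt => /andP[x0x /orP[/eqP->|xl]]; first exact: v2.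
  rewrite (@eq_valid _ g1) ?v1 ?x0x // => i iT; apply: e2 => /ffunP/(_ a).
  rewrite !addvE !mkpa scaleE eqxx mul1n => E.
  have := leq_add (le_corner a iT) xl; rewrite -E.
  by rewrite addnS ltnn.
rewrite e2 ?e1 // => pE; move: pn; rewrite pE !addvE mkpa mkpb !scaleE.
by rewrite eqxx mul1n (negbTE ab) mul0n add0n eqxx andbT addnA [(c a + _)%N]addnC leq_addr.
Qed.

Lemma rows_step g x0 l B : exists g',
  (forall x y, (x0 <= x < x0 + l)%N -> (y < B)%N -> valid g' (mkp x y)) /\
  (forall p : NN 2, ~~ ((x0 <= p a) && (p b < B))%N -> g' p = g p) /\
  (forall p : NN 2, ~~ ((x0 + c a <= p a) && (p b < B))%N -> g' p = g p).
Proof.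
suff: exists g',
  (forall x y, (x0 <= x < x0 + l)%N -> (y < B)%N -> valid g' (mkp x y)) /\
  (forall p : NN 2, ~~ ((x0 + c a <= p a) && (p b < B))%N -> g' p = g p).
  case=> g' [h1 h2]; exists g'; split=> //; split=> // p hp; apply: h2.
  by apply: contra hp => /andP[hp ->]; rewrite (leq_trans (leq_addr _ _) hp).
elim: B g => [|B IH] g; first by exists g.
have [g1 [v1 e1]] := row_step g x0 B l.
have [g2 [v2 e2]] := IH g1; exists g2; split=> [x y xl|p pn].
  rewrite ltnS leq_eqVlt => /orP[/eqP->|]; last exact: v2.
  rewrite (@eq_valid _ g1) ?v1 // => i iT; apply: e2.
  by rewrite negb_and -[X in _ || X]leqNgt !addvE mkpb leq_addl orbT.
rewrite e2 ?e1 //; apply: contra pn => /andP[-> pB] /=.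
  by rewrite (eqP pB).
exact: ltnW.
Qed.

Lemma rows_uniq g h (m n : NN 2) :
  (forall p, lev p (m + n) -> valid g p /\ valid h p) ->
  (forall p, lev p m -> agree g h p) ->
  (forall p, lev m p -> lev p (m + n) -> agree g h p) ->
  forall p, lev p (m + n) -> (m a <= p a)%N -> (p b <= m b)%N -> agree g h p.
Proof.
move=> vgh gm gn p; rewrite -[p]mkpK mkpa mkpb.
move: (p a) (p b) => x y {p} pmn mx ym; move: pmn.
move: {-1}(m b - y)%N (erefl (m b - y)%N) => d.
elim: d x y mx ym => [|d IHd] x y mx ym dE pmn.
  apply: gn => //; apply: (lev2 ab); rewrite ?mkpa ?mkpb //.
  by rewrite -subn_eq0 dE.
have ylt : (y < m b)%N by rewrite -subn_gt0 dE.
have [k xE] : exists k, x = (m a + k)%N by exists (x - m a)%N; rewrite subnKC.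
elim: k x mx pmn xE => [|k IHk] x mx pmn xE.
  by apply: gm; apply: (lev2 ab); rewrite ?mkpa ?mkpb // xE addn0.
have [vg vh] := vgh _ pmn.
have bE : mkp x y + ebase b = mkp x y.+1.
  by apply: (eq2 ab); rewrite addvE !(mkpa, mkpb) ffunE ?ba_false ?eqxx ?addn0 ?addn1.
have aE : mkp x y = mkp (m a + k)%N y + ebase a.
  apply: (eq2 ab); rewrite addvE !(mkpa, mkpb) ffunE ?(negbTE ab) ?eqxx ?addn0 //.
  by rewrite xE addn1 addnS.
refine (corner_uniq vg vh _ aE _).
  rewrite bE; apply: IHd => //; first by rewrite subnS dE.
  apply: (lev2 ab); rewrite !(mkpa, mkpb).
    by move/levP/(_ a): pmn; rewrite mkpa.
  by rewrite addvE (leq_trans ylt) ?leq_addr.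
apply: IHk => //; first exact: leq_addr.
by apply: lev_trans pmn; rewrite aE lev_addl.
Qed.

End Corner.

Context (hD : invertible_corners D).

Let i0 : 'I_2 := ord0.
Let i1 : 'I_2 := ord_max.
Let i01 : i0 != i1. Proof. by []. Qed.
Let i10 : i1 != i0. Proof. by []. Qed.

Lemma glue_uniq g h (m n : NN 2) :
  (forall p, lev p (m + n) -> valid g p) ->
  (forall p, lev p (m + n) -> valid h p) ->
  (forall x, x \in tiles m -> g x = h x) ->
  (forall x, x \in tiles n -> g (x + m) = h (x + m)) ->
  forall x, x \in tiles (m + n) -> g x = h x.
Proof.
move=> vg vh gm gn x /in_tiles[i [p [iT pmn ->]]]; move: i iT.
have vgh r : lev r (m + n) -> valid g r /\ valid h r.
  by move=> rmn; split; [apply: vg|apply: vh].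
have am r : lev r m -> agree g h r.
  by move=> rm i iT; apply: gm; apply: mem_tiles.
have an r : lev m r -> lev r (m + n) -> agree g h r.
  move=> mr rmn i iT; rewrite -(subvK mr) addrA; apply: gn.
  by apply: mem_tiles => //; rewrite -(lev_add2r m) subvK // addrC.
rewrite -/(agree g h p).
case: (leqP (p i0) (m i0)) => h0; case: (leqP (p i1) (m i1)) => h1.
- by apply: am; apply: (lev2 i01).
- exact: (@rows_uniq _ _ i10 (hD i1) g h m n vgh am an p pmn (ltnW h1)).
- exact: (@rows_uniq _ _ i01 (hD i0) g h m n vgh am an p pmn (ltnW h0)).
- by apply: an => //; apply: (lev2 i01); exact: ltnW.
Qed.

Lemma glue_exists g1 g2 (m n : NN 2) :
  (forall p, lev p m -> valid g1 p) ->
  (forall p, lev p n -> valid g2 p) ->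
  (forall i, i \in T -> g1 (i + m) = g2 i) ->
  exists g, [/\ forall p, lev p (m + n) -> valid g p,
    forall x, x \in tiles m -> g x = g1 x &
    forall x, x \in tiles n -> g (x + m) = g2 x].
Proof.
move=> v1 v2 g12.
pose h x := if lev m x then g2 (subv x m) else g1 x.
have hm x : x \in tiles m -> h x = g1 x.
  move=> /in_tiles[i [j [iT jm ->]]]; rewrite /h; case: ifP => // mij.
  rewrite -[in RHS](subvK mij) g12 //; apply: tile_hered iT _.
  apply/levP=> l; rewrite subvE addvE leq_subLR [leqRHS]addnC leq_add2l.
  by move/levP: jm; apply.
have hn x : h (x + m) = g2 x.
  rewrite /h -{1}[m]add0r lev_add2r lev0; congr g2.
  by apply/ffunP=> l; rewrite subvE addvE addnK.
have [g' [vg' [wg' eg']]] := rows_step i01 (hD i0) h (m i0).+1 (n i0) (m i1).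
have [g [vg [wg eg]]] := rows_step i10 (hD i1) g' (m i1).+1 (n i1) (m i0).
have bnd x (a : 'I_2) : x \in tiles m -> (x a < (m a).+1 + c a)%N.
  move=> /in_tiles[i [j [iT /levP jm ->]]].
  by rewrite addvE addSn ltnS addnC leq_add // le_corner.
have gm x : x \in tiles m -> g x = g1 x.
  move=> xm; rewrite eg ?eg' ?hm // negb_and -ltnNge bnd //.
have gn x : g (x + m) = g2 x.
  by rewrite eg ?eg' ?hn // negb_and -[X in _ || X]leqNgt !addvE leq_addl orbT.
have up r : lev m r -> lev r (m + n) -> valid g r.
  move=> mr rmn; have rn : lev (subv r m) n.
    by rewrite -(lev_add2r m) subvK // addrC.
  suff <- : valid g2 (subv r m) = valid g r by exact: v2.
  rewrite -[in RHS](subvK mr) -valid_shift.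
  by apply: eq_valid => i _; rewrite gn.
exists g; split=> // p pmn.
case: (leqP (p i0) (m i0)) => h0; case: (leqP (p i1) (m i1)) => h1.
- have pm : lev p m by apply: (lev2 i01).
  suff <- : valid g1 p = valid g p by exact: v1.
  by apply: eq_valid => i iT; rewrite gm // mem_tiles.
- have [h0'|h0'] := ltnP (p i0) (m i0).
    rewrite -(mkpK i10 p); apply: vg => //; rewrite h1 /= addSn ltnS.
    by move/levP/(_ i1): pmn; rewrite addvE.
  by apply: up => //; apply: (lev2 i01) => //; exact: ltnW.
- have [h1'|h1'] := ltnP (p i1) (m i1).
    have <- : valid g' p = valid g p.
      apply: eq_valid => i iT; rewrite wg //.
      rewrite negb_and -[X in _ || X]leqNgt; apply/orP; right; rewrite addvE.
      by apply: leq_trans (ltnW h0) (leq_addl _ _).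
    rewrite -(mkpK i01 p); apply: vg' => //; rewrite h0 /= addSn ltnS.
    by move/levP/(_ i0): pmn; rewrite addvE.
  by apply: up => //; apply: (lev2 i01) => //; exact: ltnW.
- by apply: up => //; apply: (lev2 i01); exact: ltnW.
Qed.

Definition plook (x : tpath) : NN 2 -> 'I_q := look (pval x).

Lemma plook_valid x p : lev p (tdeg x) -> valid (plook x) p.
Proof.
move=> px; rewrite /plook -is_vertex_restr.
by move/allP: (valP (tagged x)); apply; rewrite in_box.
Qed.

Lemma path_eq x y : tdeg x = tdeg y ->
  (forall p, p \in tiles (tdeg x) -> plook x p = plook y p) -> x = y.
Proof.
case: x y => [n [f fP]] [n' [g gP]]; rewrite /tdeg /= => e.
case: n' / e g gP => g gP fg; congr Tagged; apply: val_inj => /=.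
by apply/ffunP=> i; have := fg (val i) (valP i); rewrite /plook !look_in.
Qed.

Definition fun_val n (g : NN 2 -> 'I_q) : {ffun tiles n -> 'I_q} :=
  [ffun i => g (val i)].

Lemma look_fun_val n g x : x \in tiles n -> look (fun_val n g) x = g x.
Proof. by move=> xn; rewrite -[x]/(val [` xn]%fset) look_in ffunE. Qed.

Lemma fun_valP n g : (forall p, lev p n -> valid g p) ->
  all (fun m => is_vertex (restr T (fun_val n g) m)) (box n).
Proof.
move=> vg; apply/allP=> m; rewrite in_box is_vertex_restr => mn.
rewrite (@eq_valid _ g) ?vg // => i iT.
by rewrite look_fun_val //; apply: mem_tiles.
Qed.

Definition mkpath n g (vg : forall p, lev p n -> valid g p) : tpath :=
  Tagged path_of (exist (fun l : {ffun tiles n -> 'I_q} =>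
    all (fun m => is_vertex (restr T l m)) (box n)) _ (fun_valP vg)).

Lemma plook_mkpath n g (vg : forall p, lev p n -> valid g p) x :
  x \in tiles n -> plook (mkpath vg) x = g x.
Proof. exact: look_fun_val. Qed.

Lemma trng_subproof (x : tpath) : is_vertex (restr T (pval x) 0).
Proof. by rewrite is_vertex_restr plook_valid ?lev0. Qed.

Lemma tsrc_subproof (x : tpath) : is_vertex (restr T (pval x) (tdeg x)).
Proof. by rewrite is_vertex_restr plook_valid ?lev_refl. Qed.

Definition trng (x : tpath) : vert := exist is_vertex _ (trng_subproof x).

Definition tsrc (x : tpath) : vert := exist is_vertex _ (tsrc_subproof x).

Lemma tidm_subproof (v : vert) p : lev p 0 -> valid (look (val v)) p.
Proof.
move=> /levP p0; have -> : p = 0.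
  by apply/ffunP=> a; have := p0 a; rewrite ffunE leqn0 => /eqP.
have := valP v; rewrite /is_vertex /valid.
by under eq_bigr => i _ do rewrite -look_in -[val i]addr0.
Qed.

(* v seen as a function on tiles 0, which is T. *)
Definition tidm (v : vert) : tpath := mkpath (tidm_subproof v).

Lemma plook_tidm v x : x \in T -> plook (tidm v) x = look (val v) x.
Proof. by move=> xT; rewrite plook_mkpath // tile_tiles. Qed.

Lemma vert_eq (v w : vert) :
  (forall i, i \in T -> look (val v) i = look (val w) i) -> v = w.
Proof.
move=> vw; apply/val_inj/ffunP=> i.
by rewrite -!look_in vw //; apply: valP.
Qed.

Lemma look_trng x i : i \in T -> look (val (trng x)) i = plook x i.
Proof. by move=> iT; rewrite /= look_restr // addr0. Qed.

Lemma look_tsrc x i : i \in T -> look (val (tsrc x)) i = plook x (i + tdeg x).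
Proof. by move=> iT; rewrite /= look_restr. Qed.

Lemma tcompP x y : tsrc x = trng y ->
  [/\ tdeg (tcomp x y) = tdeg x + tdeg y,
      forall p, p \in tiles (tdeg x) -> plook (tcomp x y) p = plook x p &
      forall p, p \in tiles (tdeg y) ->
        plook (tcomp x y) (p + tdeg x) = plook y p].
Proof.
move=> sr; rewrite /tcomp; case: pickP => [l /andP[/eqP lx /eqP ly]|nol].
  split=> // p pT.
    by rewrite /(plook x) -lx look_restr // addr0.
  by rewrite /(plook y) -ly look_restr.
have [|||g [vg gx gy]] := @glue_exists (plook x) (plook y) (tdeg x) (tdeg y).
- exact: plook_valid.
- exact: plook_valid.
- by move=> i iT; rewrite -look_tsrc // -look_trng // sr.
have := nol (tagged (mkpath vg)); case/negP; apply/andP; split.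
  apply/eqP/ffunP=> i; rewrite ffunE -[RHS]look_in look_fun_val; last first.
    by rewrite addr0; apply: tiles_mono (valP i) (lev_addl _ _).
  by rewrite addr0 gx //; apply: valP.
apply/eqP/ffunP=> i; rewrite ffunE -[RHS]look_in look_fun_val ?gy //.
  exact: valP.
by apply: tiles_shift; apply: valP.
Qed.

Lemma path_uniq x y m n : tdeg x = m + n -> tdeg y = m + n ->
  (forall p, p \in tiles m -> plook x p = plook y p) ->
  (forall p, p \in tiles n -> plook x (p + m) = plook y (p + m)) -> x = y.
Proof.
move=> dx dy xm xn; apply: path_eq; first by rewrite dx.
rewrite dx; apply: glue_uniq => // p pmn; apply: plook_valid; rewrite ?dx ?dy //.
Qed.

Lemma trng_tidm v : trng (tidm v) = v.
Proof. by apply: vert_eq => i iT; rewrite look_trng // plook_tidm. Qed.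

Lemma tsrc_tidm v : tsrc (tidm v) = v.
Proof.
by apply: vert_eq => i iT; rewrite look_tsrc // addr0 plook_tidm.
Qed.

Lemma trng_tcomp x y : tsrc x = trng y -> trng (tcomp x y) = trng x.
Proof.
case/tcompP=> dxy cx cy; apply: vert_eq => i iT.
by rewrite !look_trng // cx // tile_tiles.
Qed.

Lemma tsrc_tcomp x y : tsrc x = trng y -> tsrc (tcomp x y) = tsrc y.
Proof.
case/tcompP=> dxy cx cy; apply: vert_eq => i iT.
rewrite !look_tsrc // dxy [tdeg x + _]addrC addrA cy //.
by apply: mem_tiles => //; apply: lev_refl.
Qed.

Lemma tcomp_idl x : tcomp (tidm (trng x)) x = x.
Proof.
have /tcompP[d c1 c2] : tsrc (tidm (trng x)) = trng x by rewrite tsrc_tidm.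
apply: path_eq => [|p]; rewrite d add0r // => px.
by rewrite -[p in LHS]addr0 c2.
Qed.

Lemma tcomp_idr x : tcomp x (tidm (tsrc x)) = x.
Proof.
have /tcompP[d c1 c2] : tsrc x = trng (tidm (tsrc x)) by rewrite trng_tidm.
by apply: path_eq => [|p]; rewrite d addr0 // => px; rewrite c1.
Qed.

Lemma tcomp_assoc x y z : tsrc x = trng y -> tsrc y = trng z ->
  tcomp x (tcomp y z) = tcomp (tcomp x y) z.
Proof.
move=> xy yz.
have [d1 a1 b1] := tcompP xy; have [d2 a2 b2] := tcompP yz.
have /tcompP[d3 a3 b3] : tsrc x = trng (tcomp y z) by rewrite trng_tcomp.
have /tcompP[d4 a4 b4] : tsrc (tcomp x y) = trng z by rewrite tsrc_tcomp.
have d4' : tdeg (tcomp (tcomp x y) z) = tdeg x + tdeg (tcomp y z).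
  by rewrite d4 d1 d2 addrA.
apply: (path_uniq d3 d4') => p px.
  rewrite a3 // a4 ?a1 // d1; apply: tiles_mono px _; exact: lev_addl.
rewrite (b3 p px); rewrite d2 in px; move: p px.
apply: glue_uniq => p.
- by move=> pp; apply: plook_valid; rewrite d2.
- move=> pp; rewrite valid_shift; apply: plook_valid.
  by rewrite d4' d2 [tdeg x + _]addrC lev_add2r.
- move=> py; rewrite a2 // a4 ?b1 // d1; exact: tiles_shift.
- by move=> pz; rewrite b2 // -addrA [tdeg y + _]addrC -d1 b4.
Qed.

Lemma tdeg_tidm v : tdeg (tidm v) = 0.
Proof. by []. Qed.

Lemma tdeg_tcomp x y : tsrc x = trng y -> tdeg (tcomp x y) = tdeg x + tdeg y.
Proof. by case/tcompP. Qed.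

Lemma tfactorization x (m n : NN 2) : tdeg x = m + n ->
  exists! p : tpath * tpath, [/\ tdeg p.1 = m, tdeg p.2 = n,
    tsrc p.1 = trng p.2 & x = tcomp p.1 p.2].
Proof.
move=> dx.
have v1 p : lev p m -> valid (plook x) p.
  by move=> pm; apply: plook_valid; rewrite dx (lev_trans pm) ?lev_addl.
have v2 p : lev p n -> valid (fun r => plook x (r + m)) p.
  by move=> pn; rewrite valid_shift plook_valid // dx [m + n]addrC lev_add2r.
have sr : tsrc (mkpath v1) = trng (mkpath v2).
  apply: vert_eq => i iT; rewrite look_tsrc // look_trng //.
  rewrite (plook_mkpath v2) ?tile_tiles // (plook_mkpath v1) //.
  exact: mem_tiles (lev_refl _).
have [d c1 c2] := tcompP sr.
exists (mkpath v1, mkpath v2); split=> [|[y z] /= [dy dz yz xE]].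
  split=> //; apply: (path_uniq dx d) => p pT.
    by rewrite c1 // plook_mkpath.
  by rewrite [p + m]/(p + tdeg (mkpath v1)) c2 // plook_mkpath.
have [d' c1' c2'] := tcompP yz; congr pair; apply: path_eq => // p pT.
  by rewrite plook_mkpath // xE c1' // dy.
by rewrite plook_mkpath // xE -dy c2' // dz.
Qed.

Definition tile_graph : kgraph 2 :=
  @KGraph 2 vert tpath trng tsrc tidm tcomp tdeg
    trng_tidm tsrc_tidm trng_tcomp tsrc_tcomp tcomp_idl tcomp_idr tcomp_assoc
    tdeg_tidm tdeg_tcomp tfactorization.

End TileGraph.

(* Main.v *)
Require Import Defs.
From mathcomp Require Import all_boot all_order all_algebra finmap.

Set Implicit Arguments.
Unset Strict Implicit.
Unset Printing Implicit Defensive.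

Import GRing.Theory.
Local Open Scope ring_scope.

(** Write [e0], [e1] for the two generators of degree. Both dynamical
conditions say that a configuration which is already known away from the
origin extends to the origin in exactly one way.

An infinite path is the same thing as a configuration [g], a labelling of the
whole quadrant satisfying the vertex equation at every point ([symbols],
[of_configuration], [symbols_inj]), and the shifts become translations
([symbols_shift]). Two configurations [g1] and [g2] with
[g1 (p + e0) = g2 (p + e1)] for all [p] together label every nonzero point: one
is placed at [e1], the other at [e0], and their overlap agrees. A common
preimage under the two shifts is a value at the origin, and the only equation
that involves this value is the vertex equation at [0], where it appears with
coefficient the rule at the origin. The same happens for a path of degree [e0]
and a path of degree [e1] with the same source: they label every point of
[tiles (e0 + e1)] except the origin ([tiles_ebase2]), and completing them to a
commuting square is choosing the value at the origin.

If the rule is invertible at the origin, the equation has exactly one solution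
([unit_origin_extend], [unit_origin_uniq]), which gives both *-commutation and
coalignment. Conversely only the uniqueness half is used: start from any
configuration, or any path of degree [e0 + e1], and add to its value at the
origin an element killed by the rule there. This is another solution, hence the
same one, so multiplication by the rule at the origin has trivial kernel modulo
[q] and is invertible ([unit_origin_of_rigid]). This needs a configuration to
start from, and the two given invertible corners provide it: they allow every
vertex to be prolonged by [e0] and by [e1], and prolonging forever along the
diagonal exhausts the quadrant ([configuration_exists]). *)

(** * The vertex equation solved for one of its variables *)

(** A common factor [d > 1] of [a] and [q] would make [q / d] a nonzero element
of the kernel; so [a] and [q] are coprime, and Bezout gives the inverse. *)
Lemma unit_mod_of_trivial_kernel q (a : 'I_q) :
  (forall b : nat, q %| a * b -> q %| b)%N -> unit_mod a.
Proof.
move=> ker; have q0 : (0 < q)%N := leq_ltn_trans (leq0n _) (ltn_ord a).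
have cop : gcdn a q = 1%N.
  apply/eqP; rewrite eqn_leq gcdn_gt0 q0 orbT andbT leqNgt; apply/negP=> d1.
  have /ker : (q %| a * (q %/ gcdn a q))%N by rewrite muln_divCA_gcd dvdn_mulr.
  have d0 : (0 < gcdn a q)%N by apply: ltnW.
  move/dvdn_leq; rewrite divn_gt0 // dvdn_leq ?dvdn_gcdr // leqNgt ltn_Pdiv //.
  by move/(_ isT).
case: (posnP a) => [a0|a0].
  have q1 : q = 1%N by rewrite -cop a0 gcd0n.
  have mod0 m : (m %% q = 0)%N by rewrite q1 modn1.
  by exists a; rewrite !mod0.
case: (egcdnP q a0) => u v uv _.
exists (Ordinal (ltn_pmod u q0)) => /=.
by rewrite modnMmr mulnC uv cop modnMDl.
Qed.

Section Pivot.
Context (D : basic_data).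
Local Notation T := (tile D).
Local Notation q := (alph D).

Lemma origin_in_tile : 0 \in T.
Proof.
have /fset0Pn[i iT] := tile_neq0 D; exact: tile_hered iT (lev0 i).
Qed.

Lemma alph_gt0 : (0 < q)%N.
Proof. exact: leq_ltn_trans (leq0n _) (ltn_ord (trace D)). Qed.

(** In the equation at [n], the value at [val k + n] has the coefficient
[rule k], which can be cancelled. *)
Lemma pivot_uniq (k : T) (g h : NN 2 -> 'I_q) n : unit_mod (rule k) ->
  valid g n -> valid h n ->
  (forall i, i \in T -> i != val k -> g (i + n) = h (i + n)) ->
  g (val k + n) = h (val k + n).
Proof.
case=> v uv vg vh gh; move: vg vh; rewrite !(modq_sub k).
rewrite (eq_bigr (fun i : T => rule i * h (val i + n)%R)%N); last first.
  by move=> i ik; rewrite gh ?(valP i) // (inj_eq val_inj).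
move=> /eqP e1 /eqP e2; move/eqP: e1; rewrite -e2 eqn_modDr => /eqP e.
apply: val_inj => /=.
rewrite -[LHS](modn_small (ltn_ord _)) -[RHS](modn_small (ltn_ord _)).
have E (z : 'I_q) : (z = v * (rule k * z) %[mod q])%N.
  by rewrite mulnA [(v * _)%N]mulnC -modnMml uv modnMml mul1n.
by rewrite [LHS]E [RHS]E -modnMmr e modnMmr.
Qed.

Lemma pivot_step (k : T) (g : NN 2 -> 'I_q) n : unit_mod (rule k) ->
  exists g', valid g' n /\ forall x, x != val k + n -> g' x = g x.
Proof.
case=> v uv; pose A := (\sum_(i : T | i != k) rule i * g (val i + n)%R)%N.
pose z := Ordinal (ltn_pmod (v * (trace D + A * q.-1)) alph_gt0).
exists (fun x => if x == val k + n then z else g x); split; last first.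
  by move=> x /negbTE->.
rewrite (modq_sub k) eqxx.
rewrite (eq_bigr (fun i : T => rule i * g (val i + n)%R)%N); last first.
  by move=> i ik; rewrite (inj_eq (@addv_inj n)) (inj_eq val_inj) (negbTE ik).
rewrite -/A /= -modnDml modnMmr mulnA -modnMml uv modnMml mul1n modnDml.
by rewrite -addnA -mulnSr prednK ?alph_gt0 // addnC modnMDl.
Qed.

Lemma addv_eq0 (i n : NN 2) : (i + n == 0) = (i == 0) && (n == 0).
Proof.
apply/eqP/andP=> [e|[/eqP-> /eqP->]]; last by rewrite addr0.
by split; apply/eqP/ffunP=> a; move/ffunP/(_ a)/eqP: e;
   rewrite !ffunE addn_eq0 => /andP[/eqP e1 /eqP e2].
Qed.

Lemma valid_off_origin (g h : NN 2 -> 'I_q) n :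
  (forall x : NN 2, x != 0 -> h x = g x) -> n != 0 -> valid h n = valid g n.
Proof.
by move=> hg n0; apply: eq_valid => i _; rewrite hg // addv_eq0 (negbTE n0) andbF.
Qed.

(** Adding to [g 0] an element annihilated by the rule at the origin produces
another solution [h], so rigidity makes that annihilator trivial. *)
Lemma unit_origin_of_rigid (g : NN 2 -> 'I_q) : valid g 0 ->
  (forall h, valid h 0 -> (forall x : NN 2, x != 0 -> h x = g x) -> h 0 = g 0) ->
  unit_at D 0.
Proof.
move=> vg rigid; pose k : T := [` origin_in_tile]%fset.
exists k; split=> //; apply: unit_mod_of_trivial_kernel => b qb.
pose z := Ordinal (ltn_pmod (g 0 + b) alph_gt0).
have := rigid (fun x => if x == 0 then z else g x).
rewrite eqxx => /(_ _ _)/(congr1 val)/= zE.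
suff : (g 0%R + b = g 0%R %[mod q])%N.
  by move/eqP; rewrite -{2}[val (g 0)]addn0 eqn_modDl mod0n.
rewrite zE ?[RHS]modn_small // => [|x /negbTE->//].
move: vg; rewrite !(modq_sub k) addr0 eqxx.
rewrite [X in _ -> (_ + X == _ %[mod _])%N](eq_bigr
  (fun i : T => rule i * g (val i + 0)%R)%N); last first.
  move=> i ik; rewrite addr0 -[val i == 0]/(val i == val k).
  by rewrite (inj_eq val_inj) (negbTE ik).
rewrite /= => /eqP <-; rewrite -[X in (X == _)%N]modnDml modnMmr mulnDr.
have -> : ((rule k * g 0%R + rule k * b) %% q = rule k * g 0%R %% q)%N.
  by rewrite -modnDmr (eqP qb) addn0.
by rewrite modnDml.
Qed.

Lemma subvDK (p m : NN 2) : subv (p + m) m = p.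
Proof. by apply/ffunP=> l; rewrite subvE addvE addnK. Qed.

Lemma ebase_neq0 (a : 'I_2) : ebase a != 0.
Proof. by apply/eqP=> /ffunP/(_ a); rewrite !ffunE eqxx. Qed.

Lemma lev_ebase (a : 'I_2) (p : NN 2) : lev (ebase a) p = (0 < p a)%N.
Proof.
apply/levP/idP=> [/(_ a)|pa b]; first by rewrite ffunE eqxx.
by rewrite ffunE; case: eqP => [<-|].
Qed.

Lemma le0v (p : NN 2) : lev p 0 -> p = 0.
Proof.
by move/levP=> p0; apply/ffunP=> a; have := p0 a; rewrite ffunE leqn0 => /eqP.
Qed.

Lemma neq0_ebase (a b : 'I_2) (p : NN 2) : a != b -> p != 0 ->
  lev (ebase a) p \/ lev (ebase b) p.
Proof.
move=> ab p0; rewrite !lev_ebase; case: (posnP (p a)) => [pa|]; last by left.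
case: (posnP (p b)) => [pb|]; last by right.
by case/eqP: p0; apply: (eq2 ab); rewrite ?pa ?pb ffunE.
Qed.

Lemma le_ebase_cases (a : 'I_2) (p : NN 2) :
  lev p (ebase a) -> p = 0 \/ p = ebase a.
Proof.
move=> /levP pa; case: (posnP (p a)) => p0; [left|right]; apply/ffunP=> b.
  by have := pa b; rewrite !ffunE; case: eqP => [<- //|_]; case: (p b).
apply/eqP; rewrite eqn_leq pa ffunE; case: eqP => [<-//|//].
Qed.

Lemma unit_origin_uniq (g h : NN 2 -> 'I_q) : unit_at D 0 ->
  valid g 0 -> valid h 0 -> (forall i, i \in T -> i != 0 -> g i = h i) ->
  g 0 = h 0.
Proof.
case=> k [kE uk] vg vh gh; have := pivot_uniq uk vg vh.
by rewrite kE addr0; apply=> i iT; rewrite addr0; apply: gh.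
Qed.

(** Placing [g1] at [ebase j] and [g2] at [ebase i] labels every nonzero point,
and the origin is left to solve the equation there. Nothing is assumed about
the overlap: where both labellings apply [g1] wins, and [g2] is recovered at
the points where they agree. Hence the lemma serves for infinite paths, which
agree everywhere, and for finite ones, whose junk values outside their domain
need not agree. *)
Lemma unit_origin_extend (i j : 'I_2) (g1 g2 : NN 2 -> 'I_q) :
  i != j -> unit_at D 0 ->
  exists g, [/\ valid g 0, forall p, g (p + ebase j) = g1 p &
    forall p, (forall r, p = r + ebase j -> g1 (r + ebase i) = g2 p) ->
      g (p + ebase i) = g2 p].
Proof.
move=> ij [k [kE uk]].
pose f x := if lev (ebase j) x then g1 (subv x (ebase j))
            else g2 (subv x (ebase i)).
have [g [vg gf]] := pivot_step f 0 uk.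
rewrite kE addr0 in gf; exists g; split=> // p.
  rewrite gf ?addv_eq0 ?(negbTE (ebase_neq0 _)) ?andbF //.
  by rewrite /f addrC lev_addl addrC subvDK.
move=> agr; rewrite gf ?addv_eq0 ?(negbTE (ebase_neq0 _)) ?andbF // /f subvDK.
case: ifP => //; rewrite lev_ebase addvE ffunE (negbTE ij) addn0 => pj.
have jp : lev (ebase j) p by rewrite lev_ebase.
rewrite -(agr (subv p (ebase j))) ?subvK //; congr g1.
by rewrite -{1}(subvK jp) addrAC subvDK.
Qed.

End Pivot.

(** * Finite paths as windows of a labelling of the quadrant *)

Section Reads.
Context (D : basic_data) (hD : invertible_corners D).
Local Notation T := (tile D).
Local Notation q := (alph D).
Local Notation L := (tile_graph hD).
Implicit Types (x y : tpath D) (g h : NN 2 -> 'I_q) (m n p : NN 2).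

(** The path is the window of [g] at [m]. Paths of different degrees have
different types; comparing each of them with one total labelling turns
composition and equality of paths into statements about [g]. *)
Definition reads x g m : Prop :=
  forall p, p \in tiles D (tdeg x) -> plook x p = g (p + m).

Lemma reads_self x : reads x (plook x) 0.
Proof. by move=> p _; rewrite addr0. Qed.

Lemma reads_eq x y g m : tdeg x = tdeg y -> reads x g m -> reads y g m -> x = y.
Proof. by move=> d rx ry; apply: path_eq => // p px; rewrite rx ?ry // -d. Qed.

Lemma reads_exists g m n : (forall p, lev p n -> valid g (p + m)) ->
  exists x, tdeg x = n /\ reads x g m.
Proof.
move=> vg; have v p : lev p n -> valid (fun r => g (r + m)) p.
  by move=> pn; rewrite valid_shift vg.
by exists (mkpath v); split=> // p pn; rewrite plook_mkpath.
Qed.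

Lemma reads_valid x g m p : reads x g m -> lev p (tdeg x) -> valid g (p + m).
Proof.
move=> rx px; rewrite -valid_shift -(@eq_valid _ (plook x)) ?plook_valid //.
by move=> i iT; rewrite rx //; apply: mem_tiles.
Qed.

Lemma reads_src x y g m n : reads x g m -> reads y g n -> n = tdeg x + m ->
  tsrc x = trng y.
Proof.
move=> rx ry nE; apply: vert_eq => i iT.
rewrite look_tsrc // look_trng // ry ?tile_tiles // nE addrA.
by rewrite rx // mem_tiles // lev_refl.
Qed.

(** The two windows do not cover [tiles (tdeg x + tdeg y)]; the values in the
uncovered regions are forced by the invertible corners, provided [g] satisfies
the equations there. *)
Lemma reads_tcomp x y g m n : n = tdeg x + m -> reads x g m -> reads y g n ->
  (forall p, lev p (tdeg x + tdeg y) -> valid g (p + m)) ->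
  reads (tcomp x y) g m.
Proof.
move=> nE rx ry vg; have [d cx cy] := tcompP hD (reads_src rx ry nE).
rewrite /reads d; apply: (@glue_uniq D hD (plook (tcomp x y)) (fun p => g (p + m))).
- by move=> p pd; apply: plook_valid; rewrite d.
- by move=> p pd; rewrite valid_shift vg.
- by move=> p px; rewrite cx // rx.
- by move=> p py; rewrite cy // ry // nE addrA.
Qed.

Lemma reads_tcomp_split x y g m : tsrc x = trng y -> reads (tcomp x y) g m ->
  reads x g m /\ reads y g (tdeg x + m).
Proof.
case/(tcompP hD)=> d cx cy r; split=> p pT.
  by rewrite -cx // r // d; apply: tiles_mono pT (lev_addl _ _).
by rewrite -cy // r ?addrA // d; apply: tiles_shift.
Qed.

(** A nonzero point has a positive coordinate; the unit to subtract there is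
taken from the translation part of the point, or from the tile, which is
hereditary, when the translation part has none. *)
Lemma tiles_ebase2 (i j : 'I_2) p : i != j ->
  p \in tiles D (ebase i + ebase j) -> p != 0 ->
  (exists2 r, r \in tiles D (ebase j) & p = r + ebase i) \/
  (exists2 r, r \in tiles D (ebase i) & p = r + ebase j).
Proof.
move=> ij /in_tiles[l [m [lT mij pE]]] p0.
have in_tiles_sub (a b : 'I_2) : a != b -> lev m (ebase a + ebase b) ->
    lev (ebase a) p -> subv p (ebase a) \in tiles D (ebase b).
  move=> ab /levP mab; rewrite lev_ebase pE addvE => pa.
  have := mab a; have := mab b.
  rewrite !addvE !ffunE !eqxx (eq_sym b) !(negbTE ab) addn0 => mb ma.
  case: (posnP (m a)) => ma0.
    have -> : subv (l + m) (ebase a) = subv l (ebase a) + m.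
      apply/ffunP=> c; rewrite !(addvE, subvE) ffunE; case: eqP => [<-|_].
        by rewrite ma0 !addn0.
      by rewrite !subn0.
    apply: mem_tiles; last by apply: (lev2 ab); rewrite ?ma0 // ffunE eqxx.
    by apply: tile_hered lT _; apply/levP=> c; rewrite subvE leq_subr.
  have -> : subv (l + m) (ebase a) = l + subv m (ebase a).
    apply/ffunP=> c; rewrite !(addvE, subvE) ffunE; case: eqP => [<-|_].
      by rewrite addnBA.
    by rewrite !subn0.
  apply: mem_tiles => //; apply: (lev2 ab); rewrite subvE !ffunE !eqxx.
    by rewrite eq_sym (negbTE ab) leq_subLR addn0.
  by rewrite (negbTE ab) subn0.
case: (neq0_ebase ij p0) => h; [left|right].
  by exists (subv p (ebase i)); rewrite ?subvK // in_tiles_sub.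
exists (subv p (ebase j)); rewrite ?subvK // in_tiles_sub // 1?eq_sym //.
by rewrite addrC.
Qed.

(** * Coalignment *)

(** The labelling [g] obtained from [ei] at [ebase j], [ej] at [ebase i] and the
solved value at [0] is the unique path of degree [ebase i + ebase j] ending in
both [ei] and [ej]; [fi] and [fj] are its initial segments. *)
Lemma unit_origin_coaligned : unit_at D 0 -> one_coaligned L.
Proof.
move=> u0 i j ij ei ej di dj sij.
have dij : tdeg ei = ebase i := di.
have djj : tdeg ej = ebase j := dj.
have [g [vg gi gj']] := unit_origin_extend (plook ei) (plook ej) ij u0.
have ri : reads ei g (ebase j) by move=> p _; rewrite gi.
have rj : reads ej g (ebase i).
  move=> p; rewrite djj => pj; rewrite gj' // => r pE.
  (* The two edges only overlap in their common source. *)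
  have rT : r \in T.
    move: pj; rewrite pE => /in_tiles[l [m [lT mj]]].
    case/le_ebase_cases: mj => ->; last by move/addv_inj->.
    by rewrite addr0 => rl; apply: (tile_hered lT); rewrite -rl lev_addl.
  by rewrite -dij pE -djj -!look_tsrc //; congr (look (val _) _).
have vij p : lev p (ebase i + ebase j) -> valid g (p + 0).
  rewrite addr0 => pij; have [->//|/(neq0_ebase ij)[] ap] := eqVneq p 0.
    rewrite -(subvK ap); apply: (reads_valid rj); rewrite djj.
    by rewrite -(lev_add2r (ebase i)) subvK // addrC.
  rewrite -(subvK ap); apply: (reads_valid ri); rewrite dij.
  by rewrite -(lev_add2r (ebase j)) subvK.
have [|fi [dfi rfi]] := @reads_exists g 0 (ebase i).
  by move=> p pi; apply: vij; apply: lev_trans pi (lev_addl _ _).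
have [|fj [dfj rfj]] := @reads_exists g 0 (ebase j).
  by move=> p pj; apply: vij; apply: lev_trans pj _; rewrite addrC lev_addl.
have ni : ebase i = tdeg fi + 0 by rewrite dfi addr0.
have nj : ebase j = tdeg fj + 0 by rewrite dfj addr0.
have si := reads_src rfi rj ni; have sj := reads_src rfj ri nj.
exists (fi, fj); split=> [|[hi hj] /= [dhi dhj shi shj hE]].
  split=> //=; apply: (@reads_eq _ _ g 0).
  - by rewrite !(tdeg_tcomp hD) // dfi dfj dij djj addrC.
  - by apply: reads_tcomp ni rfi rj _; rewrite dfi djj.
  - by apply: reads_tcomp nj rfj ri _; rewrite dfj dij addrC.
pose y : tpath D := tcomp hi ej.
have dy : tdeg y = ebase i + ebase j.
  by rewrite (tdeg_tcomp hD) // djj; congr (_ + _).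
have [rhi rej] := reads_tcomp_split shi (@reads_self y).
have [|rhj rei] := @reads_tcomp_split hj ei (plook y) 0 shj.
  by rewrite -[tcomp hj ei]hE; exact: reads_self.
rewrite addr0 [tdeg _]dhi in rej; rewrite addr0 [tdeg _]dhj in rei.
have off p : p \in tiles D (tdeg y) -> p != 0 -> plook y p = g p.
  rewrite dy => py p0; have [[r rT ->]|[r rT ->]] := tiles_ebase2 ij py p0.
    by rewrite -rej -?rj // djj.
  by rewrite -rei -?ri // dij.
have y0 : plook y 0 = g 0.
  apply: unit_origin_uniq u0 _ vg _; first exact: plook_valid (lev0 _).
  by move=> l lT; apply: off; apply: tile_tiles.
have ry p : p \in tiles D (ebase i + ebase j) -> plook y p = g p.
  by move=> pT; have [->//|] := eqVneq p 0; apply: off; rewrite dy.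
congr pair; apply: (@reads_eq _ _ g 0) => //.
- by rewrite dfi [RHS]dhi.
- move=> p pT; rewrite rhi // addr0 ry //; apply: tiles_mono pT _.
  by rewrite [tdeg _]dhi lev_addl.
- by rewrite dfj [RHS]dhj.
- move=> p pT; rewrite rhj // addr0 ry //; apply: tiles_mono pT _.
  by rewrite [tdeg _]dhj addrC lev_addl.
Qed.


(** Let [ei] and [ej] be the final edges of a path [x] of degree [e0 + e1]. Every
labelling [h] that differs from [x] at most at the origin and satisfies the
equation there is again a path with the final edges [ei] and [ej]. Its initial
edges are then those of [x], and they contain the value at the origin. *)
Lemma coaligned_unit_origin (x : tpath D) :
  tdeg x = ebase ord0 + ebase ord_max -> one_coaligned L -> unit_at D 0.
Proof.
set i := ord0; set j := ord_max => dx coal.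
have vx p : lev p (ebase i + ebase j) -> valid (plook x) p.
  by move=> px; apply: plook_valid; rewrite dx.
have [|ei [dei rei]] := @reads_exists (plook x) (ebase j) (ebase i).
  by move=> p pi; apply: vx; rewrite lev_add2r.
have [|ej [dej rej]] := @reads_exists (plook x) (ebase i) (ebase j).
  by move=> p pj; apply: vx; rewrite [ebase i + _]addrC lev_add2r.
have pair h : valid h 0 -> (forall p : NN 2, p != 0 -> h p = plook x p) ->
  exists f : tpath D * tpath D, [/\ reads f.1 h 0,
    tdeg f.1 = ebase i, tdeg f.2 = ebase j, tsrc f.1 = trng ej &
    tsrc f.2 = trng ei /\ tcomp f.1 ej = tcomp f.2 ei].
  move=> vh0 hx; have vh p : lev p (ebase i + ebase j) -> valid h (p + 0).
    move=> px; rewrite addr0; have [->//|p0] := eqVneq p 0.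
    by rewrite (valid_off_origin hx p0) vx.
  have ri : reads ei h (ebase j).
    by move=> p pT; rewrite rei // hx // addv_eq0 (negbTE (ebase_neq0 _)) andbF.
  have rj : reads ej h (ebase i).
    by move=> p pT; rewrite rej // hx // addv_eq0 (negbTE (ebase_neq0 _)) andbF.
  have [|fi [dfi rfi]] := @reads_exists h 0 (ebase i).
    by move=> p pi; apply: vh; apply: lev_trans pi (lev_addl _ _).
  have [|fj [dfj rfj]] := @reads_exists h 0 (ebase j).
    by move=> p pj; apply: vh; apply: lev_trans pj _; rewrite addrC lev_addl.
  have ni : ebase i = tdeg fi + 0 by rewrite dfi addr0.
  have nj : ebase j = tdeg fj + 0 by rewrite dfj addr0.
  have si := reads_src rfi rj ni; have sj := reads_src rfj ri nj.
  exists (fi, fj); split=> //; split=> //; apply: (@reads_eq _ _ h 0).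
  - by rewrite !(tdeg_tcomp hD) // dfi dfj dei dej addrC.
  - by apply: reads_tcomp ni rfi rj _; rewrite dfi dej.
  - by apply: reads_tcomp nj rfj ri _; rewrite dfj dei addrC.
apply: (@unit_origin_of_rigid _ (plook x)); first exact: plook_valid (lev0 _).
move=> h vh hx.
have [|//|fx [rx dx1 dx2 sx1 [sx2 ex]]] := pair (plook x).
  exact: plook_valid (lev0 _).
have [fh [rh dh1 dh2 sh1 [sh2 eh]]] := pair h vh hx.
have sij : tsrc ei = tsrc ej.
  apply: vert_eq => l lT; rewrite !look_tsrc //.
  by rewrite rei ?rej ?mem_tiles ?lev_refl // dei dej addrAC.
have [f [_ uf]] := coal i j isT ei ej dei dej sij.
have e1 : f = fx by apply: uf; split.
have e2 : f = fh by apply: uf; split.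
have o0 n : 0 \in tiles D n by apply: tile_tiles; apply: origin_in_tile.
by move: (rx 0 (o0 _)) (rh 0 (o0 _)); rewrite -e1 e2 => -> /=; rewrite !addr0.
Qed.

(** * Existence of configurations *)

(** The new vertex lies at [ebase a]; its corner [ebase a *+ c a + ebase a] is
outside the tile, so adjusting the value there solves the new equation without
touching [v]. *)
Lemma extend_ebase (v : vert D) (a : 'I_2) :
  exists x : tpath D, tdeg x = ebase a /\ trng x = v.
Proof.
have [g [vg gv]] := corner_step (hD a) (look (val v)) (ebase a).
have gT i : i \in T -> g i = look (val v) i.
  move=> iT; apply: gv => iE; have := le_corner a iT.
  have ea : ebase a a = 1%N by rewrite ffunE eqxx.
  by rewrite iE addvE scaleE ea eqxx mul1n addn1 ltnn.
have [p|x [dx rx]] := @reads_exists g 0 (ebase a).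
  rewrite addr0 => /le_ebase_cases[]-> //.
  rewrite (@eq_valid _ _ (look (val v))) => [|i iT]; last by rewrite addr0 gT.
  exact/tidm_subproof/lev_refl.
exists x; split=> //; apply: vert_eq => i iT.
by rewrite look_trng // rx ?tile_tiles // addr0 gT.
Qed.

(** Stated with boolean equalities so that [xchoose] selects a square. *)
Lemma extend_square (v : vert D) :
  exists x : tpath D, (tdeg x == ebase ord0 + ebase ord_max) && (trng x == v).
Proof.
have [x [dx rx]] := extend_ebase v ord0.
have [y [dy ry]] := extend_ebase (tsrc x) ord_max.
by exists (tcomp x y); rewrite (tdeg_tcomp hD) // (trng_tcomp hD) // dx dy rx !eqxx.
Qed.

Definition square (v : vert D) : tpath D := xchoose (extend_square v).

Lemma vertex_exists : inhabited (vert D).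
Proof.
have [g [vg _]] := corner_step (hD ord0) (fun=> trace D) 0.
have [p /le0v->|x _] := @reads_exists g 0 0; first by rewrite addr0.
by split; apply: (trng x).
Qed.

Fixpoint staircase (v : vert D) (n : nat) : tpath D :=
  if n is n'.+1 then let x := staircase v n' in tcomp x (square (tsrc x))
  else tidm v.

(** Each staircase path extends the previous one, and the [n]-th one is defined
at every point with coordinates at most [n], so the value at [p] may be read from
the staircase of length [p ord0 + p ord_max], and from any longer one. *)
Lemma configuration_exists : exists g, forall n, valid g n.
Proof.
have [v] := vertex_exists.
pose x := staircase v; pose e : NN 2 := ebase ord0 + ebase ord_max.
have sq w : tdeg (square w) = e /\ trng (square w) = w.
  by have /andP[/eqP-> /eqP->] := xchooseP (extend_square w).
have step (n : nat) : tdeg (x n.+1) = tdeg (x n) + e /\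
    forall p, p \in tiles D (tdeg (x n)) -> plook (x n.+1) p = plook (x n) p.
  have [d r] := sq (tsrc (x n)).
  by have [dx xl _] := tcompP hD (esym r); rewrite -d.
have dxE (n : nat) a : tdeg (x n) a = n.
  elim: n => [|n IH]; first by rewrite ffunE.
  have [-> _] := step n; rewrite addvE IH addvE !ffunE.
  by case: a {IH} => [[|[|//]] ?]; rewrite addn1.
have inx p (n : nat) : (p ord0 <= n)%N -> (p ord_max <= n)%N -> p \in tiles D (tdeg (x n)).
  move=> p0 p1; rewrite -[p]add0r; apply: mem_tiles; first exact: origin_in_tile.
  by apply: (@lev2 ord0 ord_max); rewrite ?dxE.
have stable p (n k : nat) : p \in tiles D (tdeg (x n)) ->
    plook (x (n + k)%N) p = plook (x n) p.
  move=> pn; elim: k => [|k IH]; first by rewrite addn0.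
  rewrite addnS; have [_ ->//] := step (n + k)%N.
  apply: tiles_mono pn _; apply/levP=> a; rewrite !dxE; exact: leq_addr.
pose sz p : nat := (p ord0 + p ord_max)%N.
exists (fun p => plook (x (sz p)) p) => n.
(* All points of the tile at n are within the reach of this one staircase. *)
pose N := (sz n + (corner T ord0 + corner T ord_max))%N.
rewrite (@eq_valid _ _ (plook (x N))) ?plook_valid // => [|i iT].
  apply: (@lev2 ord0 ord_max); rewrite ?dxE // /N /sz.
    by rewrite -!addnA leq_addr.
  by rewrite -addnA addnCA leq_addr.
have szN : (sz (i + n)%R <= N)%N.
  rewrite /N /sz !addvE addnACA addnC leq_add2l.
  by rewrite leq_add // le_corner.
rewrite -(subnKC szN) stable //; apply: inx.
  exact: leq_addr.
exact: leq_addl.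
Qed.

End Reads.

(** * Infinite paths are configurations *)

Section InfinitePaths.
Context (D : basic_data) (hD : invertible_corners D).
Local Notation T := (tile D).
Local Notation q := (alph D).
Local Notation L := (tile_graph hD).
Implicit Types (x y z : inf_path L) (g h : NN 2 -> 'I_q) (m n p : NN 2).

(** The origin belongs to the tile, so the vertex at [n] shows a symbol there;
these symbols determine the whole path. *)
Definition symbols x (n : NN 2) : 'I_q := look (val (fobj x n : vert D)) 0.

Definition Omega_pair m n (mn : lev m n) : mor (Omega 2) :=
  exist (fun p : NN 2 * NN 2 => lev p.1 p.2) (m, n) mn.

Lemma tdeg_fmor x (u : mor (Omega 2)) : tdeg (fmor x u) = Omega_deg u.
Proof. exact: (fmor_deg x u). Qed.

Lemma tdeg_fmor_pair x m n (mn : lev m n) :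
  tdeg (fmor x (Omega_pair mn)) + m = n.
Proof. by rewrite tdeg_fmor; apply: subvK. Qed.

(** The segment from [n] to [i + n] has [i] among its points: as a point of its
range it carries the symbol [i] of the vertex at [n], as the base point of its
source it carries the symbol [0] of the vertex at [i + n]. *)
Lemma look_fobj x n i : i \in T -> look (val (fobj x n : vert D)) i = symbols x (i + n).
Proof.
move=> iT; have nin : lev n (i + n) by rewrite addrC lev_addl.
pose l : tpath D := fmor x (Omega_pair nin).
have r : trng l = fobj x n := fmor_rng x (Omega_pair nin).
have s : tsrc l = fobj x (i + n) := fmor_src x (Omega_pair nin).
rewrite /symbols -r -s look_trng // look_tsrc ?origin_in_tile // add0r.
by congr plook; apply: (@addv_inj n); rewrite tdeg_fmor_pair.
Qed.

Lemma symbols_valid x n : valid (symbols x) n.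
Proof.
have := valP (fobj x n : vert D); rewrite /is_vertex /valid.
by under eq_bigr => i _ do rewrite -look_in look_fobj ?(valP i) //.
Qed.

(** A point [i + r] of the segment from [m] to [n] is the point [i] of the
range of its final segment, which starts at [r + m]. *)
Lemma reads_fmor x (u : mor (Omega 2)) :
  reads (fmor x u) (symbols x) (Omega_rng u).
Proof.
case: u => [[m n] /= mn]; rewrite -/(Omega_pair mn) /Omega_rng /=.
move=> p /in_tiles[i [r [iT rd ->]]].
have rmn : lev (r + m) n.
  by rewrite -(tdeg_fmor_pair x mn) lev_add2r.
have mrm : lev m (r + m) by rewrite addrC lev_addl.
pose l1 : tpath D := fmor x (Omega_pair mrm).
pose l2 : tpath D := fmor x (Omega_pair rmn).
have d1 : tdeg l1 = r by apply: (@addv_inj m); rewrite tdeg_fmor_pair.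
have r2 : trng l2 = fobj x (r + m) := fmor_rng x (Omega_pair rmn).
have s1 : tsrc l1 = fobj x (r + m) := fmor_src x (Omega_pair mrm).
have lE : fmor x (Omega_pair mn) = tcomp l1 l2 :> tpath D.
  have -> : Omega_pair mn = Omega_comp (Omega_pair mrm) (Omega_pair rmn).
    by apply: Omega_eq; rewrite ?Omega_rng_comp ?Omega_src_comp.
  exact: (fmor_comp x).
have [d c1 c2] := tcompP hD (etrans s1 (esym r2)).
rewrite lE -{1}d1 c2; last exact: tile_tiles.
by rewrite -look_trng // r2 look_fobj // addrA.
Qed.

Lemma symbols_inj x y : symbols x =1 symbols y -> x = y.
Proof.
move=> xy; apply: kfunctor_eq => [n|u].
  by apply: (@vert_eq D) => i iT; rewrite !look_fobj.
apply: (@reads_eq D _ _ (symbols y) (Omega_rng u)).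
- by rewrite !tdeg_fmor.
- by move=> p pT; rewrite reads_fmor.
- exact: reads_fmor.
Qed.

Section OfConfiguration.
Context (g : NN 2 -> 'I_q) (vg : forall n, valid g n).

Lemma window_valid n p m : lev p n -> valid (fun r => g (r + m)) p.
Proof. by move=> _; rewrite valid_shift. Qed.

Definition window (u : mor (Omega 2)) : tpath D :=
  mkpath (fun p => @window_valid (Omega_deg u) p (Omega_rng u)).

Lemma reads_window u : reads (window u) g (Omega_rng u).
Proof. by move=> p pT; rewrite plook_mkpath. Qed.

Definition window_vertex (n : NN 2) : vert D := trng (window (Omega_idm n)).

Lemma window_rng u : trng (window u) = window_vertex (Omega_rng u).
Proof.
apply: vert_eq => i iT.
by rewrite /window_vertex !look_trng // !reads_window ?tile_tiles.
Qed.

Lemma Omega_src_deg (u : mor (Omega 2)) : Omega_src u = Omega_deg u + Omega_rng u.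
Proof. by rewrite subvK //; apply: (valP u). Qed.

Lemma window_src u : tsrc (window u) = window_vertex (Omega_src u).
Proof.
apply: (reads_src (@reads_window u) (@reads_window _)).
exact: Omega_src_deg.
Qed.

Lemma window_idm n : window (Omega_idm n) = tidm (window_vertex n).
Proof.
apply: path_eq => [|p]; rewrite [tdeg _]Omega_deg_idm // => /tiles0 pT.
by rewrite plook_tidm // look_trng.
Qed.

Lemma window_comp (u v : mor (Omega 2)) : Omega_src u = Omega_rng v ->
  window (Omega_comp u v) = tcomp (window u) (window v).
Proof.
move=> uv; have sr : tsrc (window u) = trng (window v).
  by rewrite window_src window_rng uv.
apply: (@reads_eq D _ _ g (Omega_rng u)).
- by rewrite (tdeg_tcomp hD) //; apply: Omega_deg_comp.
- by rewrite -(Omega_rng_comp uv); apply: reads_window.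
- apply: (reads_tcomp hD _ (@reads_window u) (@reads_window v)).
    by rewrite -uv; apply: Omega_src_deg.
  by move=> p _.
Qed.

Definition of_configuration : inf_path L :=
  @KFunctor 2 (Omega 2) L window_vertex window window_rng window_src
    window_idm window_comp (fun=> erefl).

Lemma symbols_of_configuration : symbols of_configuration =1 g.
Proof.
move=> n; rewrite /symbols -[fobj _ _]/(trng (window (Omega_idm n))).
rewrite look_trng ?origin_in_tile //.
rewrite reads_window ?add0r //.
by apply: tile_tiles; apply: origin_in_tile.
Qed.

End OfConfiguration.

Lemma symbols_shift m x n : symbols (shift m x) n = symbols x (n + m).
Proof. by []. Qed.

(** * Shifts *)

Lemma shift_comm m n x : shift m (shift n x) = shift n (shift m x).
Proof. by apply: symbols_inj => p; rewrite !symbols_shift addrAC. Qed.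

(** Let [x] be any infinite path, with configuration [g]. A solution [h] that
differs from [g] at most at the origin is the configuration of an infinite path
with the same two shifts as [x], hence of [x]. *)
Lemma star_commute_unit_origin :
  star_commute (@shift 2 L (ebase ord0)) (@shift 2 L (ebase ord_max)) ->
  unit_at D 0.
Proof.
case=> _ star; have [g vg] := configuration_exists hD.
apply: (@unit_origin_of_rigid _ g) => // h vh0 hg.
have vh n : valid h n.
  by have [->//|n0] := eqVneq n 0; rewrite (valid_off_origin hg n0).
pose x := of_configuration vg; pose y := of_configuration vh.
have shift_eq a : shift (ebase a) y = shift (ebase a) x.
  apply: symbols_inj => n; rewrite !symbols_shift !symbols_of_configuration hg //.
  by rewrite addv_eq0 (negbTE (ebase_neq0 _)) andbF.
have [w [_ uw]] := star _ _ (shift_comm (ebase ord0) (ebase ord_max) x).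
have yx : y = x.
  by rewrite -(uw x) // -(uw y).
by rewrite -(symbols_of_configuration vh) -(symbols_of_configuration vg) -/y yx.
Qed.

Lemma unit_origin_star_commute : unit_at D 0 ->
  star_commute (@shift 2 L (ebase ord0)) (@shift 2 L (ebase ord_max)).
Proof.
set i := ord0; set j := ord_max => u0.
have ij : i != j by [].
split=> [x|y z yz]; first exact: shift_comm.
have yzE r : symbols y (r + ebase i) = symbols z (r + ebase j).
  by rewrite -!symbols_shift yz.
have [g [vg0 gy gz]] := unit_origin_extend (symbols y) (symbols z) ij u0.
have {}gz p : g (p + ebase i) = symbols z p by apply: gz => r ->.
have vg p : valid g p.
  have [->//|/(neq0_ebase ij)[]/subvK<-] := eqVneq p 0; rewrite -valid_shift.
    rewrite (@eq_valid _ _ (symbols z)) => [|l _]; last exact: gz.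
    exact: symbols_valid.
  rewrite (@eq_valid _ _ (symbols y)) => [|l _]; last exact: gy.
  exact: symbols_valid.
exists (of_configuration vg); split.
  by split; apply: symbols_inj => p; rewrite symbols_shift symbols_of_configuration.
move=> x [xy xz]; apply: symbols_inj => p; rewrite symbols_of_configuration.
have off r : r != 0 -> g r = symbols x r.
  case/(neq0_ebase ij)=> /subvK<-; first by rewrite gz -symbols_shift xz.
  by rewrite gy -symbols_shift xy.
have [->|/off//] := eqVneq p 0.
apply: unit_origin_uniq => //; first exact: symbols_valid.
by move=> l _; apply: off.
Qed.

End InfinitePaths.

Theorem corollary3p4 (D : basic_data) (hD : invertible_corners D) :
  [<-> star_commute (@shift 2 (tile_graph hD) (ebase ord0))
                    (@shift 2 (tile_graph hD) (ebase ord_max));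
       one_coaligned (tile_graph hD);
       three_invertible_corners D].
Proof.
tfae.
- by move/star_commute_unit_origin/unit_origin_coaligned.
- have [v] := vertex_exists hD.
  have [x /andP[/eqP dx _]] := extend_square hD v.
  by move/(coaligned_unit_origin dx).
- by case=> u0 _; apply: unit_origin_star_commute.
Qed.
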